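(* The following two assertions are equivalent: (I) For every finite group $G$, the following three conditions are equivalent: (1) $G$ has a transversal; (2) Sylow $2$-subgroups of $G$ are trivial or non-cyclic; (3) there is an ordering $g_1,\dots,g_n$ of the elements of $G$ such that $g_1\cdots g_n=1$. (II) For every finite group $G$, $G$ has a transversal if and only if $G$ has a regular row transversal.
   Context: The multiplication table of $G$ is the set of triples $\{(x,y,xy):x,y\in G\}$; in a triple $(x,y,z)$, $x$ is the row, $y$ the column and $z$ the entry. A transversal of $G$ is a subset of the multiplication table in which each element of $G$ appears precisely once as a row, once as a column and once as an entry. A regular row transversal of $G$ is a subset $T$ of the multiplication table such that each element of $G$ appears as the row of precisely one triple in $T$, and every $s\in G$ appears as a column of triples in $T$ the same number of times as it appears as an entry of triples in $T$. *)

(* Defs.v *)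
From mathcomp Require Import all_boot all_fingroup all_solvable.

Set Implicit Arguments.
Unset Strict Implicit.
Unset Printing Implicit Defensive.

Local Open Scope group_scope.

Section MultiplicationTable.

Variable gT : finGroupType.
Implicit Types (G : {group gT}) (T : {set gT * gT * gT}).

Definition trow (t : gT * gT * gT) : gT := t.1.1.
Definition tcol (t : gT * gT * gT) : gT := t.1.2.
Definition tentry (t : gT * gT * gT) : gT := t.2.

Definition mul_table G : {set gT * gT * gT} :=
  [set (x, y, x * y) | x in G, y in G].

Definition nb_row T (g : gT) : nat := #|[set t in T | trow t == g]|.
Definition nb_col T (g : gT) : nat := #|[set t in T | tcol t == g]|.
Definition nb_entry T (g : gT) : nat := #|[set t in T | tentry t == g]|.

(* Not to be confused with the transversals of a set partition of finset. *)
Definition table_transversal G T : Prop :=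
  T \subset mul_table G /\
  forall g, g \in G -> [/\ nb_row T g = 1%N, nb_col T g = 1%N & nb_entry T g = 1%N].

Definition regular_row_transversal G T : Prop :=
  [/\ T \subset mul_table G,
      forall g, g \in G -> nb_row T g = 1%N
    & forall s, s \in G -> nb_col T s = nb_entry T s].

Definition has_transversal G : Prop := exists T, table_transversal G T.

Definition has_regular_row_transversal G : Prop :=
  exists T, regular_row_transversal G T.

Definition sylow2_trivial_or_noncyclic G : Prop :=
  forall P : {group gT}, 2.-Sylow(G) P -> P :=: 1 \/ ~~ cyclic P.

Definition ordering_with_product_one G : Prop :=
  exists s : seq gT, [/\ uniq s, s =i G & \prod_(x <- s) x = 1].

End MultiplicationTable.

(* Main.v *)
Require Import Defs.
From mathcomp Require Import all_boot all_fingroup all_solvable.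
From mathcomp Require Import ssralg zify.

(* A regular row transversal forces the Sylow 2-subgroup S to be trivial or non-cyclic: if S = <[s]> is non-trivial, the transfer f : G -> S is a morphism
   with f s a generator of S, so the sum of f over G is the involution of S, whereas summing
   f over the rows, columns and entries of the transversal shows that this sum is zero.

   Conversely, the condition on S gives an ordering of G with product 1, unconditionally.
   If S is non-cyclic, a quotient of S of order 4 gives such an ordering of S. An involution
   t outside S is not centralised by S, so the S-orbits of these involutions have even size;
   as t * h * t ^ h = h, the involutions of an orbit can be inserted two by two around
   elements of S without changing the product. The remaining elements of G are paired with
   their inverses. Finally the partial products of such an ordering are the columns of a
   regular row transversal. *)

Set Implicit Arguments.
Unset Strict Implicit.
Unset Printing Implicit Defensive.

Import GroupScope GRing.Theory.

(** * Sums of a morphism over a regular row transversal *)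

Lemma regular_row_transversal_sum (gT : finGroupType) (G : {group gT})
    (A : zmodType) (f : gT -> A) T :
    {in G &, {morph f : x y / x * y >-> (x + y)%R}} ->
    regular_row_transversal G T -> (\sum_(x in G) f x = 0)%R.
Proof.
move=> fM [/subsetP sT Trow Tce].
have count_sum (h : gT * gT * gT -> gT) : {in T, forall t, h t \in G} ->
    (\sum_(t in T) f (h t) = \sum_(x in G) f x *+ #|[set t in T | h t == x]|)%R.
  move=> hG; rewrite (partition_big h (mem G)) //=; apply: eq_bigr => x _.
  rewrite (eq_bigr (fun=> f x)) => [|t /andP[_ /eqP->] //].
  by rewrite sumr_const; congr (_ *+ _)%R; apply: eq_card => t; rewrite !inE.
have TG t : t \in T ->
    [/\ trow t \in G, tcol t \in G & tentry t = trow t * tcol t].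
  by case/sT/imset2P=> x y Gx Gy ->.
have Hrow : (\sum_(t in T) f (trow t) = \sum_(x in G) f x)%R.
  rewrite (count_sum (@trow gT)) => [|t /TG[]//].
  by apply: eq_bigr => x /Trow; rewrite /nb_row => ->.
have Hentry : (\sum_(t in T) f (tentry t) = \sum_(t in T) f (tcol t))%R.
  rewrite (count_sum (@tentry gT)) => [|t /TG[Gr Gc ->]]; last exact: groupM.
  rewrite (count_sum (@tcol gT)) => [|t /TG[]//].
  by apply: eq_bigr => x /Tce; rewrite /nb_col /nb_entry => ->.
apply: (addIr (\sum_(t in T) f (tcol t))%R); rewrite add0r -Hrow -big_split -Hentry.
by apply: eq_bigr => t /TG[Gr Gc ->]; rewrite fM.
Qed.

(** * Transfer into a cyclic Sylow 2-subgroup *)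

Section CyclicSylow.

Variables (gT : finGroupType) (G : {group gT}) (s : gT).
Hypotheses (sylS : 2.-Sylow(G) <[s]>) (s1 : s != 1).

Let sSG : <[s]> \subset G := pHall_sub sylS.

Let Gs : s \in G. Proof. by rewrite -cycle_subG. Qed.

Let order_s : {k | #[s] = (2 ^ k.+1)%N}.
Proof.
have /p_natP[[|k] Es] : 2.-nat #[s] := pHall_pgroup sylS; last by exists k.
by case/eqP: s1; apply/eqP; rewrite -order_eq1 Es.
Qed.

Let odd_index : odd #|G : <[s]>|.
Proof. by rewrite odd_2'nat; case/and3P: sylS. Qed.

(** [s ^+ i] generates [<[s]>] exactly when [i] is prime to the 2-power [#[s]]. As conjugation
    preserves orders, parities of exponents can be compared between conjugates. *)
Lemma odd_exponent_order i : odd i = (#[s ^+ i] == #[s]).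
Proof.
have [k Es] := order_s.
rewrite -coprime2n -(@coprime_pexpl k.+1) // -Es -generator_coprime /generator.
by rewrite eq_sym eqEcard cycleX /= eqn_leq [X in X && _]dvdn_leq ?orderXdvd.
Qed.

Lemma cyclic_sylow2_transfer :
  exists (A : zmodType) (f : gT -> A),
   [/\ {in G &, {morph f : x y / x * y >-> (x + y)%R}},
       forall x, (f x *+ #[s] = 0)%R & (f s *+ #[s]./2 != 0)%R].
Proof.
(* [transfer] takes its values in the abelian image of a morphism, here the identity of [<[s]>];
   [fmod] makes that image additive. *)
have abS : abelian (idm <[s]> @* <[s]>) by rewrite morphim_idm ?cycle_abelian.
have ES : idm <[s]> @* <[s]> = <[s]> by apply: morphim_idm.
have AS x : x \in idm <[s]> @* <[s]> -> x \in <[s]> by rewrite ES.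
have As : s \in idm <[s]> @* <[s]> by rewrite ES cycle_id.
pose u := FiniteModule.fmod abS s.
have uX n : (u *+ n == 0)%R = (#[s] %| n)%N.
  rewrite order_dvdn -[LHS](inj_eq (@FiniteModule.fmod_inj _ _ _)).
  by rewrite FiniteModule.fmvalZ FiniteModule.fmodK.
exists (FiniteModule.fmod_of abS), (transfer G abS); split.
- exact: transferM.
- move=> x; apply: (@FiniteModule.fmod_inj _ _ _); rewrite FiniteModule.fmvalZ.
  have /cycleP[i Ei] : FiniteModule.fmval (transfer G abS x) \in <[s]>.
    by apply: AS; apply: FiniteModule.fmodP.
  apply: etrans (congr1 (fun y => y ^+ _) Ei) _.
  by rewrite -expgM mulnC expgM expg_order expg1n.
have trX := transversalP (rcosets_cycle_partition sSG Gs).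
set X := transversal _ _ in trX.
(* The length of the orbit of the coset [<[s]> :* x] under [<[s]>]; the transfer expands with one
   term per orbit. *)
pose n_ x := #|<[s]> : <[s]> :* x|.
have dlog x : exists i, s ^+ n_ x ^ x^-1 == s ^+ i.
  have := mulg_exp_card_rcosets <[s]> s x.
  by rewrite mem_rcoset /= conjgE invgK mulgA => /cycleP[i ->]; exists i.
(* [s ^+ e x] has the same order as [s ^+ n_ x], hence [e x] has the parity of [n_ x], and
   the [n_ x] add up to the odd index of [<[s]>] in [G]. *)
pose e x := xchoose (dlog x).
have eE x : s ^+ n_ x ^ x^-1 = s ^+ e x by apply/eqP; apply: (xchooseP (dlog x)).
have odd_e x : odd (e x) = odd (n_ x).
  by rewrite !odd_exponent_order -eE orderJ.
have Em : (transfer G abS s = u *+ \sum_(x in X) e x)%R.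
  rewrite (transfer_cycle_expansion sSG abS Gs trX) -sumrMnr.
  apply: eq_bigr => x Xx /=; rewrite -/(n_ x) eE.
  exact: FiniteModule.fmodX.
have odd_m : odd (\sum_(x in X) e x).
  have oddD := big_morph odd oddD (erefl : odd 0 = false).
  rewrite oddD (eq_bigr _ (fun x _ => odd_e x)) -oddD.
  by rewrite (sum_index_rcosets_cycle sSG Gs trX).
rewrite Em -mulrnA uX; have [k ->] := order_s.
rewrite expnS mul2n doubleK -mul2n dvdn_pmul2r ?expn_gt0 //.
by rewrite dvdn2 odd_m.
Qed.

(** With n = [#[s]], the exponents in [<[s]>] add up to (n/2)(n-1), where n-1 is odd. Every coset
    gives the same sum, its shift [f r *+ #[s]] being zero, and there is an odd number of cosets. *)
Lemma cyclic_sylow2_sum (A : zmodType) (f : gT -> A) :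
    {in G &, {morph f : x y / x * y >-> (x + y)%R}} ->
    (forall x, f x *+ #[s] = 0)%R ->
  (\sum_(x in G) f x = f s *+ #[s]./2)%R.
Proof.
move=> fM fn.
have f1 : f 1 = 0%R.
  by apply: (addIr (f 1)); rewrite -fM // mulg1 add0r.
have fX i : f (s ^+ i) = (f s *+ i)%R.
  by elim: i => [|i IH]; rewrite ?expg0 ?mulr0n // expgS fM ?groupX // IH mulrS.
have [k Es] := order_s.
have n2 : #[s] = #[s]./2.*2 by rewrite Es expnS mul2n doubleK.
(* Twice [f s *+ #[s]./2] is [f s *+ #[s]], hence zero: only the parity of [m] counts. *)
have odd_mul m : odd m -> (f s *+ #[s]./2 *+ m = f s *+ #[s]./2)%R.
  move=> m_odd; rewrite -{1}(odd_double_half m) m_odd mulrnDr mulr1n.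
  by rewrite -muln2 mulnC mulrnA -(mulrnA _ #[s]./2) muln2 -n2 fn mul0rn addr0.
have Scyc : (\sum_(y in <[s]>) f y = f s *+ #[s]./2)%R.
  have -> : <[s]> = [set s ^+ i | i : 'I_#[s]].
    apply/setP=> y; apply/idP/imsetP => [/cyclePmin[i lti ->]|[i _ ->]].
      by exists (Ordinal lti).
    exact: mem_cycle.
  rewrite big_imset /=; last first.
    move=> i j _ _ /eqP; rewrite eq_expg_mod_order !modn_small //.
    by move/eqP/val_inj.
  rewrite (eq_bigr _ (fun (i : 'I_#[s]) _ => fX i)) sumrMnr.
  rewrite -(big_mkord xpredT id) bin2_sum bin2 {1}n2 -doubleMl doubleK mulrnA.
  by rewrite odd_mul // -subn1 oddB ?order_gt0 // n2 odd_double.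
rewrite (set_partition_big _ (rcosets_partition sSG)) /=.
rewrite (eq_bigr (fun=> f s *+ #[s]./2)%R).
  by rewrite sumr_const odd_mul.
move=> _ /rcosetsP[r Gr ->].
rewrite -rcosetE /rcoset big_imset; last by move=> x y _ _ /mulIg.
rewrite (eq_bigr (fun x => f x + f r)%R) => [|x Sx].
  by rewrite big_split /= Scyc sumr_const -[#|_|]/#[s] fn addr0.
by rewrite fM // (subsetP sSG).
Qed.

End CyclicSylow.

Lemma regular_row_transversal_sylow2 (gT : finGroupType) (G : {group gT}) :
  has_regular_row_transversal G -> sylow2_trivial_or_noncyclic G.
Proof.
move=> [T rrT] P sylP; case: (boolP (cyclic P)) => [/cyclicP[s Ps]|]; last by right.
left; apply/eqP; rewrite Ps cycle_eq1; apply: contraT => s1.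
rewrite Ps in sylP; have [A [f [fM fn]]] := cyclic_sylow2_transfer sylP s1.
rewrite -(cyclic_sylow2_sum sylP s1 fM fn).
by rewrite (regular_row_transversal_sum fM rrT) eqxx.
Qed.

(** * Orderings of non-cyclic 2-groups *)

Lemma mulg_notin_index2 (gT : finGroupType) (G M : {group gT}) x y :
    M \subset G -> #|G : M| = 2%N -> x \in G -> y \in G ->
  x \notin M -> y \notin M -> x * y \in M.
Proof.
move=> sMG iM Gx Gy nMx nMy; rewrite -[y]invgK -mem_rcoset.
by rewrite (rcoset_index2 sMG iM) ?inE ?nMx // groupV nMy groupV.
Qed.

(** Two distinct maximal subgroups meet in [N] with [S / N] a Klein four-group. With [a], [b],
    [c = a * b] in the non-trivial cosets, each [n] in [N] gives a block of product
    [a * b * c^-1 = 1]. *)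
Lemma noncyclic_2group_ordering (gT : finGroupType) (S : {group gT}) :
  2.-group S -> ~~ cyclic S -> ordering_with_product_one S.
Proof.
move=> S2 ncS.
have maxS x : x \in S -> exists2 M : {group gT}, maximal M S & x \in M.
  move=> Sx; have [|ES|[M]] := @maximal_exists _ <[x]> S; rewrite ?cycle_subG //.
    by case/negP: ncS; rewrite -ES cycle_cyclic.
  by exists M.
have [M1 maxM1 _] := maxS 1 (group1 S).
have nsM1 := p_maximal_normal S2 maxM1.
have /andP[sM1S /subsetPn[a Sa nM1a]] := maxgroupp maxM1.
(* [M2] contains [a], so it differs from [M1]. *)
have [M2 maxM2 M2a] := maxS a Sa.
have nsM2 := p_maximal_normal S2 maxM2.
have sM2S := normal_sub nsM2.
have iM1 := p_maximal_index S2 maxM1.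
have iM2 := p_maximal_index S2 maxM2.
have [b M1b nM2b] : exists2 b, b \in M1 & b \notin M2.
  apply/subsetPn; apply: contra nM1a => sM12.
  suff /eqP-> : M1 :==: M2 by [].
  rewrite eqEcard sM12 -(leq_pmul2r (isT : 0 < 2)) -[in X in X <= _]iM2.
  by rewrite -[in X in _ <= X]iM1 !Lagrange /=.
have Sb := subsetP sM1S b M1b.
pose c := a * b; pose N := M1 :&: M2.
(* The four entries contributed by [n] lie in the four cosets of [N]. *)
pose s := flatten [seq [:: n; n^-1 * a; b * n; n^-1 * c^-1] | n <- enum N].
have cardS : (#|S| = #|N| * 4)%N.
  have M12 : M2 * M1 = S.
    apply: (mulg_normal_maximal nsM2 maxM2 sM1S).
    by apply/subsetPn; exists b.
  have := mul_cardG M1 M2; rewrite (normC (subset_trans sM1S (normal_norm nsM2))) M12.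
  rewrite -/N => EN; apply/eqP; rewrite -(eqn_pmul2l (cardG_gt0 S)) mulnA -EN.
  rewrite -{1}(Lagrange sM1S) -(Lagrange sM2S) iM1 iM2; apply/eqP; lia.
(* Since [s] has length [#|S|], covering [S] is enough to exclude repetitions. *)
have [] : (size (enum S) = size s) * (enum S =i s).
  apply: uniq_min_size; first exact: enum_uniq.
    move=> x; rewrite mem_enum => Sx; apply/flatten_mapP.
    suff [n Nn xn] :
        exists2 n, n \in N & x \in [:: n; n^-1 * a; b * n; n^-1 * c^-1].
      by exists n; rewrite ?mem_enum.
    have [M1x | M1x] := boolP (x \in M1); have [M2x | M2x] := boolP (x \in M2).
    - by exists x; rewrite !inE ?eqxx ?M1x.
    - exists (b^-1 * x); last by rewrite !inE mulKVg eqxx !orbT.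
      by rewrite inE groupM ?groupV //= (mulg_notin_index2 sM2S) ?groupV.
    - exists (a * x^-1); last by rewrite !inE (invMg a) invgK mulgKV eqxx !orbT.
      by rewrite inE (mulg_notin_index2 sM1S) ?groupM ?groupV.
    - exists (c^-1 * x^-1); last by rewrite !inE (invMg c^-1) !invgK mulgK eqxx !orbT.
      have M1c : c \notin M1 by rewrite groupMr.
      have M2c : c \notin M2 by rewrite groupMl.
      have Sc : c \in S by rewrite groupM.
      by rewrite inE (mulg_notin_index2 sM1S) ?(mulg_notin_index2 sM2S) ?groupV.
  rewrite size_flatten /shape -map_comp (eq_map (g := fun=> 4)) //.
  by rewrite sumnE big_map big_const_seq count_predT iter_addn_0 -!cardE mulnC cardS.
move=> sz eS; exists s; split=> [|x|].
- by apply: (leq_size_uniq (enum_uniq S)) => [x|]; rewrite ?eS ?sz.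
- by rewrite -eS mem_enum.
rewrite big_flatten big_map big1 // => n _.
by rewrite !big_cons big_nil /= mulg1 !mulgA mulgV mul1g mulgK mulgV.
Qed.

(** * Orderings of the whole group and their partial products *)

Lemma perm_enum_setD1 (T : finType) (A : {set T}) x :
  x \in A -> perm_eq (enum A) (x :: enum (A :\ x)).
Proof.
move=> Ax; apply: uniq_perm; rewrite /= ?enum_uniq ?mem_enum ?setD11 // => y.
by rewrite inE !mem_enum !inE; case: eqP => // ->.
Qed.

(** Induction on [#|J|]: evenness gives [t] a partner [t ^ h] in [J], and [h] in [u] becomes
    [t, h, t ^ h]. As [u] grows and [J] shrinks, [u] need only contain [S], and [J] need not be
    closed under conjugation. *)
Lemma insert_involutions (gT : finGroupType) (S : {group gT}) (J : {set gT})
    (u : seq gT) :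
    {subset S <= u} -> (forall t, t \in J -> t * t = 1) ->
    (forall x, ~~ odd #|J :&: x ^: S|) ->
  exists2 v, perm_eq v (u ++ enum J) & \prod_(x <- v) x = \prod_(x <- u) x.
Proof.
have [n] := ubnP #|J|; elim: n J u => // n IHn J u leJn Su invJ evJ.
have [-> | [t Jt]] := set_0Vmem J; first by exists u; rewrite ?enum_set0 ?cats0.
have [t' Jt' tt'] : exists2 t', t' \in J :&: t ^: S & t' != t.
  have A0 : 0 < #|(J :&: t ^: S) :\ t|.
    rewrite lt0n; apply: contraNneq (evJ t) => A0.
    by rewrite (cardsD1 t) A0 inE Jt class_refl.
  by have [t'] := card_gt0P A0; rewrite in_setD1 => /andP[]; exists t'.
have [Jt'' /imsetP[h Sh Et']] := setIP Jt'.
have u_h := Su h Sh; case/splitPr: u / u_h Su => p q Su.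
have Jt1 : t' \in J :\ t by rewrite !inE tt'.
have perm_J : perm_eq (enum J) (t :: t' :: enum (J :\ t :\ t')).
  by rewrite (perm_trans (perm_enum_setD1 Jt)) // perm_cons perm_enum_setD1.
have [||t0|x|v Ev v1] := IHn (J :\ t :\ t') (p ++ t :: h :: t' :: q).
- by move: leJn; rewrite (cardsD1 t) Jt (cardsD1 t') Jt1 ltnS; apply: ltnW.
- by move=> x /Su; rewrite !(mem_cat, inE) => /or3P[]->; rewrite ?orbT.
- by rewrite !inE => /and3P[_ _ /invJ].
(* Being conjugate under [S], [t] and [t'] leave the same class, so each count drops by 0 or 2. *)
- have := evJ x; rewrite (cardsD1 t) (cardsD1 t' (_ :\ t)) -!setIDAC.
  rewrite !inE tt' Jt Jt'' /=.
  have -> : (t' \in x ^: S) = (t \in x ^: S).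
    by rewrite Et' memJ_norm // (subsetP (class_norm x S)).
  by case: (t \in x ^: S); rewrite /= ?negbK.
exists v.
  apply/seq.permP=> d; have := seq.permP Ev d; have := seq.permP perm_J d.
  by rewrite !count_cat /=; lia.
rewrite v1 !big_cat /= !big_cons Et' conjgE /=.
by congr (_ * _); rewrite !mulgA mulgK (invJ t Jt) mul1g.
Qed.

Lemma inverse_pairs (gT : finGroupType) (K : {set gT}) :
    (forall t, t \in K -> t^-1 \in K) -> (forall t, t \in K -> t * t != 1) ->
  exists2 v, perm_eq v (enum K) & \prod_(x <- v) x = 1.
Proof.
have [n] := ubnP #|K|; elim: n K => // n IHn K leKn VK sqK.
have [-> | [t Kt]] := set_0Vmem K; first by exists [::]; rewrite ?big_nil ?enum_set0.
have Vt := VK t Kt.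
have ntV : t^-1 != t by rewrite eq_invg_mul sqK.
have Kt1 : t^-1 \in K :\ t by rewrite !inE ntV.
have perm_K : perm_eq (enum K) (t :: t^-1 :: enum (K :\ t :\ t^-1)).
  by rewrite (perm_trans (perm_enum_setD1 Kt)) // perm_cons perm_enum_setD1.
have [|y|y|v Ev v1] := IHn (K :\ t :\ t^-1).
- by move: leKn; rewrite (cardsD1 t) Kt (cardsD1 t^-1) Kt1 ltnS; apply: ltnW.
- rewrite !inE => /and3P[yV yt Ky].
  by rewrite (inj_eq invg_inj) yt (can2_eq invgK invgK) yV VK.
- by rewrite !inE => /and3P[_ _ /sqK].
exists (t :: t^-1 :: v); last by rewrite !big_cons v1 mulg1 mulgV.
by rewrite perm_sym (perm_trans perm_K) // !perm_cons perm_sym.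
Qed.

Lemma sylow2_ordering (gT : finGroupType) (G : {group gT}) :
  sylow2_trivial_or_noncyclic G -> ordering_with_product_one G.
Proof.
move=> syl2; have [S sylS] := Sylow_exists 2 G.
have sSG := pHall_sub sylS; have S2 := pHall_pgroup sylS.
have [u [uU uS u1]] : ordering_with_product_one S.
  have [S1 | ncS] := syl2 S sylS; last exact: noncyclic_2group_ordering.
  by exists [:: 1]; split=> [||]; rewrite ?big_seq1 // => x; rewrite S1 !inE.
pose J := [set t in G | (t * t == 1) && (t \notin S)].
pose K := [set t in G | (t * t != 1) && (t \notin S)].
(* If [S] centralised [y], then [y] would be a 2-element of ['N_G(S)], whose normal Sylow 2-subgroup
   is [S], so [y] would lie in [S]. *)
have fixS y : y \in J -> ~~ (S \subset 'C[y]).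
  rewrite inE => /and3P[Gy y2]; apply: contra; rewrite sub_cent1 => cSy.
  have nSy : y \in 'N_G(S) by rewrite inE Gy (subsetP (cent_sub S)).
  have sylN : 2.-Sylow('N_G(S)) S.
    by rewrite (pHall_subl _ (subsetIl G _) sylS) // subsetI sSG normG.
  rewrite (mem_normal_Hall sylN) ?normal_subnorm //.
  by apply: (@pnat_dvd _ 2); rewrite // order_dvdn expgS expg1.
have [||x|v Ev v1] := @insert_involutions _ S J u.
- by move=> x; rewrite uS.
- by move=> t; rewrite inE => /and3P[_ /eqP].
- have [-> | [y /setIP[Jy /class_eqP<-]]] := set_0Vmem (J :&: x ^: S).
    by rewrite cards0.
  have /setIidPr-> : y ^: S \subset J.
    move: Jy; rewrite inE => /and3P[Gy y2 nSy].
    apply/subsetP=> _ /imsetP[h Sh ->]; have Gh := subsetP sSG h Sh.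
    by rewrite inE groupJ // -conjMg (eqP y2) conj1g eqxx groupJr.
  (* The class size is the index of ['C_S[y]], a power of 2; if odd, it is 1 and [S] centralises
     [y]. *)
  apply: contra (fixS y Jy) => odd_yS.
  have : #|S : 'C_S[y]| == 1%N.
    rewrite index_cent1; have : 2.-nat #|y ^: S|.
      by rewrite -index_cent1; apply: pnat_dvd S2; apply: dvdn_indexg.
    by case/p_natP=> [[|k] Ek] //; move: odd_yS; rewrite Ek oddX.
  by rewrite indexg_eq1 subsetI subxx.
have [t|t|w Ew w1] := @inverse_pairs _ K.
- by rewrite !inE groupV -invMg invg_eq1 groupV.
- by rewrite inE => /and3P[].
have Evw : perm_eq (v ++ w) (u ++ enum J ++ enum K).
  by rewrite catA perm_cat.
exists (v ++ w); split.
- rewrite (perm_uniq Evw) !cat_uniq uU !enum_uniq has_cat negb_or /= andbT.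
  rewrite -!all_predC -andbA; apply/and3P; split; apply/allP=> x;
    rewrite /= !mem_enum !inE ?uS => /and3P[_ x2 nSx] //.
  by rewrite (negPf x2) andbF.
- move=> x; rewrite (perm_mem Evw) !mem_cat !mem_enum !inE uS.
  have [Sx | nSx] /= := boolP (x \in S); first by rewrite (subsetP sSG).
  by rewrite !andbT -andb_orr orbN andbT.
- by rewrite big_cat v1 u1 w1 /= mulg1.
Qed.

(* The columns are the partial products of the ordering, read from the right; multiplying
   by the rows shifts this closed walk by one step. *)
Lemma ordering_regular_row_transversal (gT : finGroupType) (G : {group gT}) :
  ordering_with_product_one G -> has_regular_row_transversal G.
Proof.
move=> [s [sU sG s1]].
pose P i := \prod_(y <- drop i s) y.
pose c x := P (index x s).+1.
have PG i : P i \in G.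
  by rewrite /P big_seq group_prod // => y /mem_drop; rewrite sG.
have cE i : i < size s -> nth 1 s i * P i.+1 = P i.
  by move=> lti; rewrite /P (drop_nth 1 lti) big_cons.
exists [set (x, c x, x * c x) | x in G].
have count_c (h : gT * gT * gT -> gT) g :
    #|[set t in [set (x, c x, x * c x) | x in G] | h t == g]| =
    \sum_(0 <= i < size s) (h (nth 1%g s i, P i.+1, P i) == g).
  have -> : [set t in [set (x, c x, x * c x) | x in G] | h t == g] =
            [set (x, c x, x * c x) | x in G & h (x, c x, x * c x) == g].
    apply/setP=> t; rewrite inE; apply/andP/imsetP=> [[/imsetP[x Gx ->] htg]|[x]].
      by exists x; rewrite // inE Gx.
    by rewrite inE => /andP[Gx htg] ->; split=> //; apply: imset_f.
  rewrite card_in_imset; last by move=> x y _ _ [].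
  rewrite -sum1_card (eq_bigl (fun x => (x \in s) && (h (x, c x, x * c x) == g))).
    rewrite big_mkcondr -big_uniq //= (big_nth 1); apply: eq_big_nat => i /= lti.
    by rewrite /c index_uniq // cE //; case: eqP.
  by move=> x; rewrite inE sG.
split.
- by apply/subsetP=> _ /imsetP[x Gx ->]; apply: imset2_f; rewrite ?PG.
- move=> g Gg; rewrite /nb_row count_c -(big_nth 1 predT (fun x => nat_of_bool (x == g))).
  rewrite (eq_bigr (fun x => if x == g then 1%N else 0%N)) => [|x _]; last by case: eqP.
  by rewrite -big_mkcond sum1_count count_uniq_mem // sG Gg.
- move=> g Gg; rewrite /nb_col /nb_entry !count_c /=.
  (* Columns run over [P 1] to [P (size s)], entries over [P 0] to [P (size s).-1]; the two
     unmatched ends are both 1. *)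
  apply: (@addnI (P 0 == g)).
  rewrite -(big_nat_recl _ _ (fun i => nat_of_bool (P i == g))) // big_nat_recr //= addnC.
  by congr (nat_of_bool (_ == g) + _)%N; rewrite /P drop_size drop0 big_nil s1.
Qed.

(** * Equivalence of the two assertions *)

Lemma transversal_regular_row_transversal (gT : finGroupType) (G : {group gT}) :
  has_transversal G -> has_regular_row_transversal G.
Proof.
by move=> [T [sT T1]]; exists T; split=> // g /T1[// _ -> ->].
Qed.

(** Regular row transversals, the Sylow condition and orderings of product 1 imply one another in a
    cycle for each group. Both assertions thus reduce to producing a transversal from any of
    these. *)
Theorem corollary10 :
  (forall (gT : finGroupType) (G : {group gT}),
     (has_transversal G <-> sylow2_trivial_or_noncyclic G) /\
     (sylow2_trivial_or_noncyclic G <-> ordering_with_product_one G))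
  <->
  (forall (gT : finGroupType) (G : {group gT}),
     has_transversal G <-> has_regular_row_transversal G).
Proof.
split=> [HP gT G | HRT gT G].
  split; first exact: transversal_regular_row_transversal.
  by move/regular_row_transversal_sylow2; case: (HP gT G) => [[]].
have rrT_syl2 := @regular_row_transversal_sylow2 gT G.
have ord_rrT := @ordering_regular_row_transversal gT G.
have syl2_ord := @sylow2_ordering gT G.
have [T_rrT rrT_T] := HRT gT G.
by split; split; auto.
Qed.
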